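(* Let $n\geqslant 4$ and let $f:\{0,1\}^n\to\mathbb{C}$ be a signature with $f\notin\mathscr{T}$ and $f(0^n)\neq 0$. Suppose that either (i) $n\geqslant 5$ and $\mathscr{S}(f)\not\subseteq\{0^n,1^n\}$, or (ii) $n=4$ and for every permutation of the four variables, $\mathscr{S}(f)$ is not contained in the image of $\{0000,1111,0011,1100\}$ under that permutation. Then there exists an index $i\in[n]$ such that $f_i^0\notin\mathscr{T}$ or $f_i^1\notin\mathscr{T}$.
   Context: A signature of arity $n\geqslant 1$ is a function $f:\{0,1\}^n\to\mathbb{C}$. Its support is $\mathscr{S}(f)=\{\alpha: f(\alpha)\neq 0\}$; $0^n,1^n$ denote the all-0 and all-1 strings. For $c\in\{0,1\}$, $f_i^c$ is the signature of arity $n-1$ on the remaining variables obtained by fixing the $i$-th variable $x_i=c$. $\mathscr{T}$ is the set of signatures that are, up to a permutation of variables, tensor products of unary and binary signatures (i.e. $f(x)=\prod_k g_k(x_{S_k})$ for a partition of the variables into blocks $S_k$ of size 1 or 2); in particular the zero signature of arity $\geqslant 2$ is in $\mathscr{T}$. (In quantum terms, $f\notin\mathscr{T}$ means the state $\sum_x f(x)|x\rangle$ exhibits multipartite entanglement.) *)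

(* Defs.v *)
From mathcomp Require Import all_boot all_fingroup all_algebra.
From mathcomp Require Import reals complex.
Set Implicit Arguments.
Unset Strict Implicit.
Unset Printing Implicit Defensive.
Import GRing.Theory.
Local Open Scope ring_scope.

(* The bit 1 is [true] and the bit 0 is [false]; [R[i]] is the field of complex
   numbers over the real numbers [R]. *)
Definition signature (R : realType) (n : nat) := n.-tuple bool -> R[i].

Definition supp (R : realType) (n : nat) (f : signature R n) :
    {set n.-tuple bool} :=
  [set x | f x != 0].

(* In [pin i c f], [unlift i] renumbers the variables other than [i] as
   0, ..., n - 2, keeping their order. *)
Definition pin (R : realType) (n : nat) (i : 'I_n) (c : bool)
    (f : signature R n) : signature R n.-1 :=
  fun x => f [tuple if unlift i k is Some j then tnth x j else c | k < n].

Definition restrict (n : nat) (B : {set 'I_n}) (x : n.-tuple bool) :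
    #|B|.-tuple bool :=
  [tuple tnth x (enum_val j) | j < #|B|].

(* The class of signatures written T (script) in the literature. The values of
   [g] on sets that are not blocks of [P] are irrelevant. *)
Definition in_T (R : realType) (n : nat) (f : signature R n) : Prop :=
  exists (P : {set {set 'I_n}}) (g : forall B : {set 'I_n}, signature R #|B|),
    [/\ partition P [set: 'I_n],
        forall B : {set 'I_n}, B \in P -> #|B| = 1%N \/ #|B| = 2%N
      & forall x : n.-tuple bool, f x = \prod_(B in P) g B (restrict B x)].

Definition zeros (n : nat) : n.-tuple bool := [tuple false | _ < n].
Definition ones (n : nat) : n.-tuple bool := [tuple true | _ < n].

(* {0000, 1111, 0011, 1100}, typed at a variable arity [n] to avoid casts; it is
   meant for [n = 4] and is empty for all other [n]. *)
Definition paired4 (n : nat) : {set n.-tuple bool} :=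
  [set x : n.-tuple bool | tval x \in
     [:: [:: false; false; false; false]; [:: true; true; true; true];
         [:: false; false; true; true]; [:: true; true; false; false]]].

Definition permute (n : nat) (s : 'S_n) (x : n.-tuple bool) : n.-tuple bool :=
  [tuple tnth x (s k) | k < n].

(* Main.v *)
Require Import Defs.
From mathcomp Require Import all_boot all_fingroup all_algebra.
From mathcomp Require Import boolp reals complex.
From mathcomp Require Import ring.
Set Implicit Arguments.
Unset Strict Implicit.
Unset Printing Implicit Defensive.
Import GRing.Theory.
Local Open Scope ring_scope.

(* Identify a bit string with the set A of its ones and f with a set function phi.
   If phi is a product of unary and binary factors, then
     phi(0)^2 phi(A) = phi(0) phi(a) phi(A-a)
       + sum_(b in A-a) (phi(0) phi(ab) - phi(a) phi(b)) phi(A-a-b),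
   so that, when phi(0) <> 0, the values on sets of size at most 2 determine phi.
   Suppose all the pinnings of f are such products. The pairs {a, b} with
   phi(0) phi(ab) <> phi(a) phi(b) then form a matching (pin to 0 a variable outside
   two incident pairs), and the product psi built on this matching agrees with phi
   except possibly on the full set. If phi(K) <> 0 for some nonempty K whose
   complement has at least 3 elements, then phi and psi, seen above K, are products
   that agree except possibly at the top, hence also there, and f = psi lies in T.
   So phi vanishes on all nonempty sets of size at most n - 3, and the recursion
   leaves only the empty set, the full set and, for n = 4, the pairs of a matching. *)

(** * Block products of set functions: exchange, covariance and recursion *)

Section SetFunctions.
Variables (C : fieldType) (T : finType).
Implicit Types (phi psi : {set T} -> C) (a b d i : T) (A B D K X Y : {set T}).

(* Division-free form of: [phi] is a product of a function of [A :&: D] and a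
   function of [A :\: D]. *)
Definition exchangeable phi D := forall X Y,
  phi X * phi Y = phi (X :&: D :|: Y :\: D) * phi (Y :&: D :|: X :\: D).

(** The trace at [a] of a product over blocks; [d = a] stands for a singleton block. *)
Definition paired phi a := exists d, exchangeable phi [set a; d].

Definition pairwise_product phi :=
  exists (P : {set {set T}}) (G : {set T} -> {set T} -> C),
    [/\ partition P [set: T], forall B, B \in P -> (#|B| <= 2)%N
      & forall A, phi A = \prod_(B in P) G B (A :&: B)].

(* For [phi set0 = 1] and phi the moments of random bits, this is a covariance. *)
Definition covar phi a b := phi set0 * phi [set a; b] - phi [set a] * phi [set b].

Lemma setD1_notin A a : a \notin A -> A :\ a = A.
Proof. by move=> aA; apply/setDidPl; rewrite disjoint_sym disjoints1. Qed.

Lemma exists_notin A : (#|A| < #|T|)%N -> exists i, i \notin A.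
Proof.
move=> AT; have : ~: A != set0 by rewrite -card_gt0 cardsCs setCK subn_gt0.
by case/set0Pn=> i; rewrite inE; exists i.
Qed.

Lemma covarC phi a b : covar phi a b = covar phi b a.
Proof. by rewrite /covar setUC [phi [set a] * _]mulrC. Qed.

Lemma exchange phi D X Y X' Y' : exchangeable phi D ->
  X :&: D :|: Y :\: D = X' -> Y :&: D :|: X :\: D = Y' ->
  phi X * phi Y = phi X' * phi Y'.
Proof. by move=> exD <- <-; apply: exD. Qed.

(** Exchanging $\{a,b\}$ with the empty set across [D] yields $\{a\}$ and $\{b\}$, so the two
    products in the covariance coincide. *)
Lemma covar_exchange phi D a b :
  exchangeable phi D -> a \in D -> b \notin D -> covar phi a b = 0.
Proof.
move=> exD aD bD; rewrite /covar mulrC (exchange exD (X' := [set a]) (Y' := [set b])).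
- by rewrite subrr.
- apply/setP=> x; rewrite !inE andbF orbF.
  case: (eqVneq x a) => [->|_]; rewrite ?aD //=.
  by case: eqVneq => [->|]; rewrite ?(negPf bD).
- apply/setP=> x; rewrite !inE /=; case: (eqVneq x a) => [->|_] /=.
    by rewrite aD; apply/esym/negbTE; apply: contraNneq bD => <-.
  by case: (eqVneq x b) => [->|_]; rewrite ?bD ?andbF.
Qed.

(* The identity does not mention the partner of [a]: only the term where [b] is
   that partner survives in the sum. *)
Lemma moment_recursion phi a A : paired phi a -> a \in A ->
  phi set0 ^+ 2 * phi A = phi set0 * phi [set a] * phi (A :\ a)
    + \sum_(b in A :\ a) covar phi a b * phi (A :\ a :\ b).
Proof.
move=> [d exD] aA.
have aD : a \in [set a; d] by rewrite !inE eqxx.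
have [/setD1P[dNa dA]|dNA] := boolP (d \in A :\ a).
- rewrite (bigD1 d) ?inE ?dNa //= big1 ?addr0; last first.
    move=> b /andP[/setD1P[bNa bA] bNd].
    by rewrite (covar_exchange exD aD) ?mul0r // !inE negb_or bNa.
  (* Exchange with the empty set splits the block $\{a,d\}$ off [A] and off [A :\ a]. By the second
     identity the linear term cancels the subtracted product in [covar phi a d]. *)
  have E1 : phi A * phi set0 = phi [set a; d] * phi (A :\ a :\ d).
    apply: (exchange exD); apply/setP=> x; rewrite !inE;
      by do 2?[case: eqVneq => [->|_]]; rewrite ?aA ?dA ?andbF.
  have E2 : phi (A :\ a) * phi set0 = phi [set d] * phi (A :\ a :\ d).
    apply: (exchange exD); apply/setP=> x; rewrite !inE;
      case: (eqVneq x d) => [->|_]; rewrite ?dNa ?dA ?andbT ?andbF ?orbT ?orbF //=;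
      case: (eqVneq x a) => [->|_]; rewrite ?aA ?andbF ?andbT ?orbF //=.
  rewrite /covar expr2 -mulrA (mulrC _ (phi A)) E1.
  have -> : phi set0 * phi [set a] * phi (A :\ a) =
    phi [set a] * (phi (A :\ a) * phi set0) by ring.
  rewrite E2; ring.
- rewrite big1 ?addr0; last first.
    move=> b bA; rewrite (covar_exchange exD aD) ?mul0r //.
    have /setD1P[bNa _] := bA.
    by rewrite !inE negb_or bNa; apply: contraNneq dNA => <-.
  have E1 : phi A * phi set0 = phi [set a] * phi (A :\ a).
    move: dNA; rewrite !inE => dNA.
    apply: (exchange exD); apply/setP=> x; rewrite !inE.
      case: (eqVneq x a) => [->|xa]; rewrite ?aA ?andbF //=.
      case: (eqVneq x d) => [xd|_]; rewrite ?andbF //=.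
      by move: dNA; rewrite -xd xa /= => /negPf->.
    case: (eqVneq x a) => [->|xa]; rewrite ?aA ?andbF //=.
    case: (eqVneq x d) => [xd|_] //=.
    by move: dNA; rewrite -xd xa /= => /negPf->.
  by rewrite expr2 -mulrA (mulrC _ (phi A)) E1; ring.
Qed.

(** The recursion at [a] involves only the empty set, singletons, pairs and smaller subsets of [A];
    all are proper because [A] has at least 3 elements. Cancelling $\phi(\emptyset)^2$ concludes. *)
Lemma paired_unique phi psi a A : paired phi a -> paired psi a -> a \in A ->
  (3 <= #|A|)%N -> phi set0 != 0 -> (forall B, B \proper A -> phi B = psi B) ->
  phi A = psi A.
Proof.
move=> pphi ppsi aA A3 phi0 eqA.
have small B : B \subset A -> (#|B| < 3)%N -> phi B = psi B.
  move=> BA B3; apply: eqA; rewrite properEcard BA.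
  exact: leq_trans B3 A3.
have e0 : phi set0 = psi set0 by apply: small; rewrite ?sub0set ?cards0.
have e1 b : b \in A -> phi [set b] = psi [set b].
  by move=> bA; apply: small; rewrite ?sub1set ?cards1.
have e2 b c : b \in A -> c \in A -> phi [set b; c] = psi [set b; c].
  move=> bA cA; apply: small; first by rewrite subUset !sub1set bA.
  by rewrite cards2 ltnS; case: (b != c).
apply: (mulfI (expf_neq0 2 phi0)).
rewrite (moment_recursion pphi aA) e0 (moment_recursion ppsi aA).
rewrite e1 // (eqA _ (properD1 aA)); congr (_ + _).
apply: eq_bigr => b bA; have /setD1P[_ bA'] := bA.
rewrite /covar e0 !e1 // e2 // eqA //.
exact: sub_proper_trans (subD1set _ _) (properD1 aA).
Qed.

(** Exchange across [B] keeps both factors at [B] and swaps the two factors at every other block. *)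
Lemma block_exchangeable phi (P : {set {set T}}) (G : {set T} -> {set T} -> C) B :
  trivIset P -> (forall A, phi A = \prod_(D in P) G D (A :&: D)) -> B \in P ->
  exchangeable phi B.
Proof.
move=> tP phiE BP X Y; rewrite !phiE -!big_split /=.
apply: eq_bigr => D DP; have [->|DB] := eqVneq D B.
  by congr (G B _ * G B _); apply/setP=> x; rewrite !inE;
     case: (x \in B); rewrite ?andbF ?andbT ?orbF.
have dis : [disjoint D & B] by move/trivIsetP: tP; apply.
rewrite mulrC; congr (G D _ * G D _); apply/setP=> x; rewrite !inE;
  by case xD: (x \in D); rewrite ?andbF // (disjointFr dis xD) ?andbF ?andbT.
Qed.

Lemma pairwise_product_paired phi a : pairwise_product phi -> paired phi a.
Proof.
move=> [P [G [partP P2 phiE]]].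
have tP := partition_trivIset partP.
have aP : a \in cover P by rewrite (cover_partition partP).
have BP := pblock_mem aP; have aB : a \in pblock P a by rewrite mem_pblock.
have ex := block_exchangeable tP phiE BP.
have := P2 _ BP; rewrite (cardsD1 a) aB ltnS leq_eqVlt ltnS leqn0 cards_eq0.
case/orP=> [/cards1P[d Bd]|/eqP B0].
  by exists d; rewrite -Bd setD1K.
by exists a; rewrite setUid -[X in exchangeable _ X]setU0 -B0 setD1K.
Qed.

Lemma exchangeable_setU phi D K :
  exchangeable phi D -> exchangeable (fun A => phi (K :|: A)) D.
Proof.
move=> exD X Y; apply: (exchange exD); apply/setP=> x; rewrite !inE;
  by do ?case: (x \in _).
Qed.

Lemma exchangeable_setD phi D K :
  exchangeable phi D -> exchangeable (fun A => phi (A :\: K)) D.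
Proof.
move=> exD X Y; apply: (exchange exD); apply/setP=> x; rewrite !inE;
  by do ?case: (x \in _).
Qed.

(** * The matching of correlated pairs and its product *)

Definition linked phi a b := (a != b) && (covar phi a b != 0).

Lemma linked_sym phi : symmetric (linked phi).
Proof. by move=> a b; rewrite /linked eq_sym covarC. Qed.

Definition is_matching phi :=
  forall a b c, linked phi a b -> linked phi a c -> b = c.

(* The blocks are the linked pairs and the unlinked points; one arbitrary block
   carries the normalising factor [phi set0]. *)
Lemma matching_product phi (a0 : T) : phi set0 != 0 -> is_matching phi ->
  exists2 psi, pairwise_product psi &
    forall A, (#|A| <= 2)%N -> psi A = phi A.
Proof.
move=> phi0 mat.
(* Transitivity of [e] is where the matching property enters: no point has two partners. *)
pose e a b := (a == b) || linked phi a b.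
have eqe : {in [set: T] & &, equivalence_rel e}.
  move=> a b c _ _ _; split; first by rewrite /e eqxx.
  rewrite /e; have [->//|/= ab lab] := eqVneq a b.
  have lba : linked phi b a by rewrite linked_sym.
  apply/orP/orP => -[/eqP eac|lac].
  - by right; rewrite -eac.
  - by left; apply/eqP/(mat a).
  - by right; rewrite -eac.
  - by left; apply/eqP/(mat b).
pose P := equivalence_partition e [set: T].
have partP : partition P [set: T] by apply: equivalence_partitionP.
have tP := partition_trivIset partP.
have pbP a : pblock P a \in P.
  by rewrite pblock_mem // (cover_partition partP).
have inpb a b : (b \in pblock P a) = e a b.
  by rewrite (pblock_equivalence_partition eqe).
pose c B := if B == pblock P a0 then phi set0 else 1.
pose G B A := c B * (phi A / phi set0).
pose psi A := \prod_(B in P) G B (A :&: B).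
have psiE A : psi A = phi set0 * \prod_(B in P) (phi (A :&: B) / phi set0).
  rewrite /psi big_split; congr (_ * _).
  by rewrite (bigD1 _ (pbP a0)) /= /c eqxx big1 ?mulr1 // => B /andP[_ /negPf->].
have psiB B A : B \in P -> A \subset B -> psi A = phi A.
  move=> BP AB; rewrite psiE (bigD1 B) //= big1 => [|D /andP[DP DB]].
    by rewrite mulr1 (setIidPl AB) mulrC divfK.
  have dis : [disjoint A & D].
    rewrite (disjointWl AB) //; move/trivIsetP: tP; apply=> //.
    by rewrite eq_sym.
  by rewrite (disjoint_setI0 dis) divff.
have P2 B : B \in P -> (#|B| <= 2)%N.
  move=> BP; have /set0Pn[a aB] : B != set0.
    by apply: contraTneq BP => ->; case/and3P: partP.
  rewrite -(def_pblock tP BP aB); case: (pickP (linked phi a)) => [b ab|nol].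
    apply: (@leq_trans #|[set a; b]|); last by rewrite cards2 ltnS leq_b1.
    apply/subset_leq_card/subsetP => d; rewrite inpb !inE /e eq_sym.
    by case/orP=> [->//|ad]; rewrite (mat _ _ _ ad ab) eqxx orbT.
  apply: (@leq_trans #|[set a]|); last by rewrite cards1.
  by apply/subset_leq_card/subsetP => d; rewrite inpb !inE /e eq_sym nol orbF.
exists psi; first by exists P, G.
move=> A.
have psi1 a : psi [set a] = phi [set a].
  by apply: (psiB (pblock P a)) => //; rewrite sub1set inpb /e eqxx.
have psi0 : psi set0 = phi set0.
  by rewrite (psiB _ _ (pbP a0)) ?sub0set.
rewrite leq_eqVlt => /orP[/cards2P[a [b [ab ->]]]|].
  have [lab|nlab] := boolP (linked phi a b).
    apply: (psiB (pblock P a)) => //.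
    by rewrite subUset !sub1set !inpb /e eqxx lab orbT.
  (* For an unlinked pair both covariances vanish, so the value at the pair is determined by those
     at the empty set and at singletons, where [psi] and [phi] agree. *)
  have c0 : covar phi a b = 0 by apply/eqP; move: nlab; rewrite /linked ab negbK.
  have : covar psi a b = 0.
    have ex := block_exchangeable tP (fun=> erefl) (pbP a) : exchangeable psi _.
    apply: (covar_exchange ex).
      by rewrite inpb /e eqxx.
    by rewrite inpb /e negb_or ab.
  move: c0; rewrite /covar psi0 !psi1 => /subr0_eq<- /subr0_eq.
  exact: mulfI.
rewrite leq_eqVlt => /orP[/cards1P[a ->//]|].
by rewrite !ltnS leqn0 cards_eq0 => /eqP->.
Qed.


(** * Set functions all of whose slices are products *)

Section Slices.
Variable phi : {set T} -> C.
Hypothesis T4 : (4 <= #|T|)%N.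
Hypothesis phi0 : phi set0 != 0.
(** A slice stays a function on subsets of all of [T] and ignores whether [i] is a member, which
    avoids a change of ground type. *)
Hypothesis phi_paired0 : forall i a, a != i -> paired (fun A => phi (A :\ i)) a.
Hypothesis phi_paired1 : forall i a, a != i -> paired (fun A => phi (i |: A)) a.

Lemma slices_matching : is_matching phi.
Proof.
move=> a b c /andP[ab cab] /andP[ac cac]; apply/eqP; apply: contraT => bc.
have [i iA] : exists i, i \notin [set a; b; c].
  apply: exists_notin; apply: leq_trans T4; rewrite ltnS.
  by rewrite -setUA !cardsU1 cards1; do ?case: (_ \notin _).
move: iA; rewrite !inE !negb_or !(eq_sym i) => /andP[/andP[ai bi] ci].
have [d exd] := phi_paired0 ai.
have covE x y : x != i -> y != i ->
    covar (fun A => phi (A :\ i)) x y = covar phi x y.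
  by move=> xi yi; rewrite /covar !setD1_notin // !inE ?negb_or ?[i == _]eq_sym ?xi.
(* At most one of [b], [c] is the partner [d] of [a] in the slice; the other has covariance 0 with
   [a]. *)
have [bd|bd] := eqVneq b d.
  move: cac; rewrite -covE // (covar_exchange exd) ?eqxx // !inE ?eqxx //.
  by rewrite negb_or [_ == a]eq_sym ac -bd eq_sym.
move: cab; rewrite -covE // (covar_exchange exd) ?eqxx // !inE ?eqxx //.
by rewrite negb_or [_ == a]eq_sym ab.
Qed.

(** Induction on the size of [A]: some [i] lies outside [A], and in the slice without [i] the
    recursion determines the value at [A]. *)
Lemma slices_unique psi A : pairwise_product psi ->
  (forall B, (#|B| <= 2)%N -> psi B = phi B) -> A != setT -> psi A = phi A.
Proof.
move=> psiP psi2; have [m] := ubnP #|A|; elim: m A => // m IH A Am AT.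
have [A2|A3] := leqP #|A| 2; first exact: psi2.
have [i iA] : exists i, i \notin A.
  by apply: exists_notin; rewrite -cardsT proper_card // properT.
have /set0Pn[a aA] : A != set0 by rewrite -card_gt0; case: #|A| A3.
have ai : a != i by apply: contraNneq iA => <-.
have [d exd] := pairwise_product_paired a psiP.
rewrite -(setD1_notin iA).
apply: (@paired_unique (fun A => psi (A :\ i)) (fun A => phi (A :\ i)) a A) => //.
- by exists d; apply: exchangeable_setD.
- exact: phi_paired0.
- by rewrite set0D psi2 ?cards0.
move=> B BA; have iB : i \notin B.
  by apply: contraNN iA; apply: (subsetP (proper_sub BA)).
rewrite setD1_notin //; apply: IH; first exact: leq_trans (proper_card BA) Am.
by apply: contraNneq iB => ->.
Qed.

Hypothesis phi_entangled : ~ pairwise_product phi.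

(* Were [phi K] nonzero, the slice of [phi] above [K] would satisfy the moment
   recursion on [~: K], and [phi setT] would be the value of the matching
   product. *)
Lemma slices_vanish K : K != set0 -> (#|K| + 3 <= #|T|)%N -> phi K = 0.
Proof.
move=> /set0Pn[i iK] K3; apply/eqP; apply: contraT => phiK.
case: phi_entangled.
have [psi psiP psi2] := matching_product i phi0 slices_matching.
have psiE A : A != setT -> psi A = phi A by apply: slices_unique.
have psiT : psi setT = phi setT.
  have CK3 : (3 <= #|~: K|)%N by rewrite cardsCs setCK leq_subRL ?(leq_trans _ K3) ?leq_addr.
  have /set0Pn[a aK] : ~: K != set0 by rewrite -card_gt0; apply: leq_trans CK3.
  have ai : a != i by apply: contraTneq aK => ->; rewrite inE iK.
  have nT B : B \proper ~: K -> K :|: B != setT.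
    move=> BK; apply: contraTneq BK => KB; rewrite properE negb_and negbK.
    apply/orP; right; apply/subsetP=> x; rewrite inE => xK.
    by have := in_setT x; rewrite -KB inE (negPf xK).
  rewrite -(setUCr K); apply: (@paired_unique (fun A => psi (K :|: A))
    (fun A => phi (K :|: A)) a (~: K)) => //.
  - have [d exd] := pairwise_product_paired a psiP.
    by exists d; apply: exchangeable_setU.
  - have [d /(exchangeable_setU K) exd] := phi_paired1 ai; exists d => X Y.
    (* As [i] lies in [K], the slice above [K] is itself a slice of the one above [i], and inherits
       its exchange property. *)
    have UK A : i |: (K :|: A) = K :|: A.
      by rewrite setUA; congr (_ :|: _); apply/setUidPr; rewrite sub1set.
    by have := exd X Y; rewrite /= !UK.
  - rewrite psiE ?setU0 //; apply: contraTneq K3 => ->.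
    by rewrite cardsT -ltnNge addn3 ltnS leqW.
  - by move=> B /nT BK; rewrite psiE.
have [P [G [PP P2 GE]]] := psiP; exists P, G; split=> // A; rewrite -GE.
by have [->|/psiE->] := eqVneq A setT; rewrite ?psiT.
Qed.

(** Singletons vanish because $1+3\le |T|$, which kills the linear term and the product part of each
    covariance. *)
Lemma slices_recursion a A : a \in A -> A != setT ->
  phi set0 ^+ 2 * phi A = \sum_(b in A :\ a) phi set0 * phi [set a; b] * phi (A :\ a :\ b).
Proof.
move=> aA AT.
have [i iA] : exists i, i \notin A.
  by apply: exists_notin; rewrite -cardsT proper_card // properT.
have ai : a != i by apply: contraNneq iA => <-.
have DA B : B \subset A -> B :\ i = B.
  by move=> BA; apply: setD1_notin; apply: contraNN iA; apply: (subsetP BA).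
have phi1 b : phi [set b] = 0.
  by apply: slices_vanish; rewrite ?cards1 // -card_gt0 cards1.
have := moment_recursion (phi_paired0 ai) aA.
rewrite /covar !DA ?sub0set ?sub1set // ?subD1set // phi1 mulr0 mul0r add0r => ->.
apply: eq_bigr => b /setD1P[_ bA].
rewrite !DA ?sub1set // ?phi1 ?mul0r ?subr0 ?subUset ?sub1set ?aA //.
by rewrite (subset_trans (subD1set _ _)) ?subD1set.
Qed.

(** Now $2+3\le |T|$, so pairs vanish too and every term of the recursion is 0. *)
Lemma slices_supp5 A : (5 <= #|T|)%N -> phi A != 0 -> A = set0 \/ A = setT.
Proof.
move=> T5 phiA; have [->|A0] := eqVneq A set0; first by left.
have [->|AT] := eqVneq A setT; first by right.
have /set0Pn[a aA] := A0.
case/eqP: phiA; apply: (mulfI (expf_neq0 2 phi0)); rewrite mulr0.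
rewrite (slices_recursion aA AT) big1 // => b _.
rewrite (slices_vanish (K := [set a; b])) ?mulr0 ?mul0r //.
  by apply/set0Pn; exists a; rewrite !inE eqxx.
by rewrite (leq_trans _ T5) // cards2; case: (a != b).
Qed.

Lemma slices_supp4 A : #|T| = 4 -> phi A != 0 -> [\/ A = set0, A = setT | #|A| = 2].
Proof.
move=> T4' phiA; have [->|A0] := eqVneq A set0; first by constructor 1.
have [->|AT] := eqVneq A setT; first by constructor 2.
have [A2|A2] := eqVneq #|A| 2; first by constructor 3.
have phi1 K : #|K| = 1 -> phi K = 0.
  by move=> K1; apply: slices_vanish; rewrite ?T4' -?card_gt0 K1.
have /set0Pn[a aA] := A0.
case/eqP: phiA; have [/phi1//|A1] := eqVneq #|A| 1.
have A3 : #|A| = 3.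
  have /proper_card : A \proper setT by rewrite properT.
  by rewrite cardsT T4'; move: A0 A1 A2; rewrite -card_gt0; case: #|A| => [|[|[|[|]]]].
apply: (mulfI (expf_neq0 2 phi0)); rewrite mulr0.
rewrite (slices_recursion aA AT) big1 // => b bA.
(* Removing two points from a set of size 3 leaves a singleton, so each term vanishes. *)
rewrite (phi1 (A :\ a :\ b)) ?mulr0 //.
by have := A3; rewrite (cardsD1 a) aA (cardsD1 b) bA => -[].
Qed.

(** Since singletons vanish, a pair in the support is linked. Distinct edges of a matching are
    disjoint, hence complementary on four points. *)
Lemma slices_supp4_pairs a b B : #|T| = 4 -> a != b -> phi [set a; b] != 0 ->
  #|B| = 2 -> phi B != 0 -> B = [set a; b] \/ B = ~: [set a; b].
Proof.
move=> T4' ab phiab /eqP/cards2P[c [d [cd ->]]] phicd.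
have phi1 x : phi [set x] = 0.
  by apply: slices_vanish; rewrite ?cards1 ?T4' // -card_gt0 cards1.
have link x y : x != y -> phi [set x; y] != 0 -> linked phi x y.
  by move=> xy pxy; rewrite /linked xy /covar !phi1 mulr0 subr0 mulf_neq0.
have lab := link _ _ ab phiab; have lba := lab; rewrite linked_sym in lba.
have lcd := link _ _ cd phicd; have ldc := lcd; rewrite linked_sym in ldc.
have mat := slices_matching.
have [ca|ca] := eqVneq c a.
  by left; rewrite ca; congr [set a; _]; apply: (mat a) => //; rewrite -ca.
have [cb|cb] := eqVneq c b.
  by left; rewrite cb setUC; congr [set _; b]; apply: (mat b) => //; rewrite -cb.
have [da|da] := eqVneq d a.
  by case/eqP: cb; apply: (mat a) => //; rewrite -da.
have [db|db] := eqVneq d b.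
  by case/eqP: ca; apply: (mat b) => //; rewrite -db.
right; apply/eqP; rewrite eqEcard subsetC subUset !sub1set !inE !negb_or.
rewrite ![a == _]eq_sym ![b == _]eq_sym ca cb da db /=.
by rewrite cardsCs setCK T4' !cards2 ab cd.
Qed.

End Slices.
End SetFunctions.

(** * Translation between signatures and set functions *)

Section Signatures.
Variable R : realType.

Definition indicator n (A : {set 'I_n}) : n.-tuple bool := [tuple k \in A | k < n].
Definition ones_of n (x : n.-tuple bool) : {set 'I_n} := [set k | tnth x k].
Definition on_sets n (f : signature R n) (A : {set 'I_n}) := f (indicator A).

Lemma ones_ofK n : cancel (@ones_of n) (@indicator n).
Proof. by move=> x; apply: eq_from_tnth => k; rewrite tnth_mktuple inE. Qed.

Lemma in_T_pairwise n (f : signature R n) : in_T f <-> pairwise_product (on_sets f).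
Proof.
split=> [[P [g [partP P2 fE]]]|[P [G [partP P2 fE]]]].
  exists P, (fun B A => g B (Defs.restrict B (indicator A))); split=> // [B /P2[]->//|A].
  rewrite /on_sets fE; apply: eq_bigr => B _; congr (g B _).
  by apply: eq_from_tnth => j; rewrite !tnth_mktuple inE enum_valP andbT.
exists P, (fun B y => G B [set enum_val j | j in ones_of y]); split=> // [B BP|x].
  (* A partition has no empty block, so size at most 2 means size 1 or 2. *)
  have : #|B| != 0 by rewrite cards_eq0; apply: contraTneq BP => ->; case/and3P: partP.
  by move: (P2 B BP); case: #|B| => [|[|[|]]]//; [left|right].
rewrite -{1}(ones_ofK x) -/(on_sets f _) fE; apply: eq_bigr => B _; congr (G B _).
apply/setP=> k; apply/setIP/imsetP=> [[]|[j]].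
  rewrite inE => xk kB; exists (enum_rank_in kB k); last by rewrite enum_rankK_in.
  by rewrite inE tnth_mktuple enum_rankK_in.
by rewrite !inE tnth_mktuple => xj ->; rewrite enum_valP.
Qed.

(** Turns the renumbering of variables in [pin] into a set operation on the original index type. *)
Lemma on_sets_pin n (i : 'I_n) c (f : signature R n) (A : {set 'I_n}) :
  on_sets (pin i c f) (lift i @^-1: A) = on_sets f (if c then i |: A else A :\ i).
Proof.
congr (f _); apply: eq_from_tnth => k; rewrite !tnth_mktuple.
case: unliftP => [j|] ->; last by case: c; rewrite !inE eqxx.
by rewrite tnth_mktuple inE; case: c; rewrite !inE eq_sym (negPf (neq_lift _ _)).
Qed.

Lemma pin_paired n (i a : 'I_n) c (f : signature R n) :
  in_T (pin i c f) -> a != i ->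
  paired (fun A => on_sets f (if c then i |: A else A :\ i)) a.
Proof.
move=> /in_T_pairwise fT; rewrite eq_sym => /unlift_some[a' -> _].
have [d exd] := pairwise_product_paired a' fT.
exists (lift i d) => X Y; rewrite -!on_sets_pin.
by apply: (exchange exd); apply/setP=> x; rewrite !inE !(inj_eq lift_inj).
Qed.

Lemma indicator4 (A : {set 'I_4}) :
  tval (indicator A) = [seq k \in A | k <- [:: inord 0; inord 1; inord 2; inord 3]].
Proof.
have -> : tval (indicator A) = [seq k \in A | k <- enum 'I_4].
  by [].
congr map; apply: (inj_map val_inj).
by rewrite val_enum_ord /= !inordK.
Qed.

Lemma permute_indicator n (s : 'S_n) (A : {set 'I_n}) :
  permute s (indicator A) = indicator (s @^-1: A).
Proof. by apply: eq_from_tnth => k; rewrite !tnth_mktuple inE. Qed.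

Lemma paired4_indicator (A : {set 'I_4}) (p := [set inord 2; inord 3] : {set 'I_4}) :
  [\/ A = set0, A = setT, A = p | A = ~: p] -> indicator A \in paired4 4.
Proof.
rewrite inE indicator4 => AE.
case: AE => ->; rewrite /= ?inE -?val_eqE /= ?inordK //.
Qed.

Lemma preimset_pair (a b : 'I_4) : a != b ->
  exists s : 'S_4, s @^-1: [set inord 2; inord 3] = [set a; b].
Proof.
move=> ab; pose t := tperm a (inord 2).
(* [t] sends [a] to 2; the second transposition fixes 2 and sends the image of [b] to 3. *)
have sa : (t * tperm (t b) (inord 3))%g a = inord 2.
  rewrite permM tpermL tpermD //; last by rewrite -val_eqE /= !inordK.
  by rewrite -[X in _ != X](tpermL a) (inj_eq perm_inj) eq_sym.
have sb : (t * tperm (t b) (inord 3))%g b = inord 3 by rewrite permM tpermL.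
move: (_ * _)%g sa sb => s sa sb; exists s; apply/setP=> k.
by rewrite !inE -sa -sb !(inj_eq perm_inj).
Qed.

End Signatures.

(** * Contradiction with the two support conditions *)

Theorem theorem2p8 (R : realType) (n : nat) (f : signature R n)
  (n_ge4 : (4 <= n)%N)
  (f_notin_T : ~ in_T f)
  (f_zeros : f (zeros n) <> 0)
  (hsupp : ((5 <= n)%N /\ ~~ (supp f \subset [set zeros n; ones n])) \/
           (n = 4%N /\ forall s : 'S_n,
              ~~ (supp f \subset [set permute s x | x in paired4 n]))) :
  exists i : 'I_n, ~ in_T (pin i false f) \/ ~ in_T (pin i true f).
Proof.
apply: contrapT => /forallNP noT.
have pinT i c : in_T (pin i c f).
  by apply: contrapT => iT; apply: (noT i); case: c iT; [right|left].
have paired0 i a := pin_paired (a := a) (pinT i false).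
have paired1 i a := pin_paired (a := a) (pinT i true).
have zerosE : zeros n = indicator set0.
  by apply: eq_from_tnth => k; rewrite !tnth_mktuple inE.
have onesE : ones n = indicator setT.
  by apply: eq_from_tnth => k; rewrite !tnth_mktuple inE.
have phi0 : on_sets f set0 != 0 by apply/eqP; rewrite /on_sets -zerosE.
have fNT : ~ pairwise_product (on_sets f) by move/in_T_pairwise.
have suppE x : x \in supp f -> on_sets f (ones_of x) != 0.
  by rewrite inE /on_sets ones_ofK.
have In : #|'I_n| = n by apply: card_ord.
have T4 : (4 <= #|'I_n|)%N by rewrite In.
case: hsupp => [[n5]|[n4 hs]].
  apply/negP; rewrite negbK; apply/subsetP=> x /suppE.
  case/(slices_supp5 T4 phi0 paired0 paired1 fNT _); rewrite ?In // => xE;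
  by rewrite -(ones_ofK x) xE !inE zerosE onesE eqxx ?orbT.
subst n; have supp4 := slices_supp4 T4 phi0 paired0 paired1 fNT In.
(* One permutation must serve the whole support: a single supported pair fixes it, since any other
   is the complement. Without such a pair the identity suffices. *)
have [s sP] : exists s : 'S_4, forall A, on_sets f A != 0 ->
    exists2 C, indicator C \in paired4 4 & A = s @^-1: C.
  have [[a b] /= /andP[ab fab]|nopair] := pickP (fun p : 'I_4 * 'I_4 =>
      (p.1 != p.2) && (on_sets f [set p.1; p.2] != 0)).
    have [s sab] := preimset_pair ab; exists s => A fA.
    case: (supp4 A fA) => [->|->|A2].
    - exists set0; last by rewrite preimset0.
      by apply: paired4_indicator; constructor 1.
    - exists setT; last by rewrite preimsetT.
      by apply: paired4_indicator; constructor 2.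
    case: (slices_supp4_pairs T4 phi0 paired0 paired1 fNT In ab fab A2 fA) => ->.
      exists [set inord 2; inord 3]; last by rewrite sab.
      by apply: paired4_indicator; constructor 3.
    exists (~: [set inord 2; inord 3]); last by rewrite preimsetC sab.
    by apply: paired4_indicator; constructor 4.
  exists 1%g => A fA; exists A; last by apply/setP=> k; rewrite inE perm1.
  apply: paired4_indicator; case: (supp4 A fA) => [->|->|A2].
  - by constructor 1.
  - by constructor 2.
  case/eqP/cards2P: A2 => a [b [ab AE]].
  by have := nopair (a, b); rewrite /= ab -AE fA.
case/negP: (hs s); apply/subsetP=> x /suppE/sP[C Cp xC].
apply/imsetP; exists (indicator C) => //.
by rewrite permute_indicator -xC ones_ofK.
Qed.
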